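(* Let $\mathcal{S}\subseteq\mathcal{L}(H)$ be a non-commutative graph (operator system) on a finite dimensional complex Hilbert space $H$. Then $c_0(\mathcal{S}) \le \hat\theta(\mathcal{S})$.
   Context: $\mathcal{L}(H)$ is the algebra of all linear operators on $H$ with the operator norm; orthogonal complements in $\mathcal{L}(H)$ are with respect to the Hilbert–Schmidt inner product $(A,B)\mapsto\mathrm{Tr}(B^*A)$; $\xi\eta^*$ is the operator $\zeta\mapsto\langle\zeta,\eta\rangle\xi$ (inner products linear in the first variable). An operator system, or non-commutative graph, in $\mathcal{L}(H)$ is a linear subspace $\mathcal{S}$ containing $I$ and closed under adjoints. A set $\{\xi_i\}_{i=1}^m\subseteq H$ of mutually orthogonal unit vectors is $\mathcal{S}$-independent if $\xi_i\xi_j^*\in\mathcal{S}^\perp$ whenever $i\ne j$. The independence number $\alpha(\mathcal{S})$ is the maximum size of an $\mathcal{S}$-independent set. The (classical zero-error) Shannon capacity of $\mathcal{S}$ is $c_0(\mathcal{S})=\lim_{n\to\infty}\sqrt[n]{\alpha(\mathcal{S}^{\otimes n})}$, where $\mathcal{S}^{\otimes n}=\mathcal{S}\otimes\cdots\otimes\mathcal{S}$ ($n$ times) $\subseteq\mathcal{L}(H^{\otimes n})$. A quantum channel is a completely positive trace preserving linear map. If $\Phi:\mathcal{L}(H)\to M_k$ is completely positive with Kraus representation $\Phi(T)=\sum_{p=1}^mA_pTA_p^*$, put $\mathcal{S}_\Phi=\mathrm{span}\{A_p^*A_q : p,q=1,\dots,m\}$ (independent of the Kraus representation), and let $\Phi^*:M_k\to\mathcal{L}(H)$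 be the dual map, determined by $\mathrm{Tr}(T\Phi^*(S))=\mathrm{Tr}(\Phi(T)S)$. Let $\mathfrak{C}(\mathcal{S})$ be the set of all quantum channels $\Phi:\mathcal{L}(H)\to M_k$, $k\in\mathbb{N}$ arbitrary, with $\mathcal{S}_\Phi\subseteq\mathcal{S}$. Then $$\hat\theta(\mathcal{S})=\inf\{\|\Phi^*(\sigma)^{-1}\| : \Phi\in\mathfrak{C}(\mathcal{S}),\ \sigma\ge 0,\ \mathrm{Tr}(\sigma)\le 1,\ \Phi^*(\sigma)\text{ invertible}\}.$$ *)

(* Defs.v *)
From HB Require Import structures.
From mathcomp Require Import all_boot all_order all_algebra.
From mathcomp Require Import complex mxtens.
From mathcomp Require Import all_classical all_reals all_analysis.

Set Implicit Arguments.
Unset Strict Implicit.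
Unset Printing Implicit Defensive.

Import Order.TTheory GRing.Theory Num.Theory.
Import numFieldNormedType.Exports.

Local Open Scope classical_set_scope.
Local Open Scope ring_scope.

(* H is C^d with the standard inner product, C = R[i], and L(H) is 'M[C]_d
   acting on column vectors. *)

Section HilbertSpace.
Context {R : realType}.
Local Notation C := R[i].

Definition adj {m n : nat} (A : 'M[C]_(m, n)) : 'M[C]_(n, m) :=
  map_mx Num.conj A^T.

Definition inner {d : nat} (x y : 'cV[C]_d) : C :=
  \sum_(i < d) x i 0 * Num.conj (y i 0).

Definition vnorm {d : nat} (x : 'cV[C]_d) : R :=
  Num.sqrt (complex.Re (inner x x)).

Definition opnorm {d : nat} (A : 'M[C]_d) : R :=
  sup [set vnorm (A *m x) | x in [set x : 'cV[C]_d | vnorm x <= 1]].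

(* 0 <= z in C means that z is real and nonnegative; over C this forces A to
   be Hermitian. *)
Definition psd {d : nat} (A : 'M[C]_d) : Prop :=
  forall x : 'cV[C]_d, 0 <= inner (A *m x) x.

Definition outer {d : nat} (x y : 'cV[C]_d) : 'M[C]_d := x *m adj y.

Lemma outerE (d : nat) (x y z : 'cV[C]_d) : outer x y *m z = inner z y *: x.
Proof.
rewrite /outer -mulmxA; apply/matrixP => i j; rewrite !mxE big_ord1 !ord1.
rewrite mulrC; congr (_ * _); rewrite mxE; apply: eq_bigr => k _.
by rewrite !mxE mulrC.
Qed.

End HilbertSpace.

Section NoncommutativeGraph.
Context {R : realType}.
Local Notation C := R[i].

Definition operator_system {d : nat} (S : {vspace 'M[C]_d}) : Prop :=
  1%:M \in S /\ forall A : 'M[C]_d, A \in S -> adj A \in S.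

Definition HS_inner {d : nat} (A B : 'M[C]_d) : C := \tr (adj B *m A).

Definition HS_orthogonal {d : nat} (S : {vspace 'M[C]_d}) (A : 'M[C]_d) :
    Prop :=
  forall B : 'M[C]_d, B \in S -> HS_inner A B = 0.

Definition independent_family {d : nat} (S : {vspace 'M[C]_d}) {m : nat}
    (xi : 'I_m -> 'cV[C]_d) : Prop :=
  [/\ forall i, vnorm (xi i) = 1,
      forall i j, i != j -> inner (xi i) (xi j) = 0
    & forall i j, i != j -> HS_orthogonal S (outer (xi i) (xi j))].

Lemma inner_ge0 (d : nat) (x : 'cV[C]_d) :
  0 <= inner x x :> C.
Proof. by apply: sumr_ge0 => i _; rewrite mul_conjC_ge0. Qed.

Lemma inner_unit (d : nat) (x : 'cV[C]_d) : vnorm x = 1 -> inner x x = 1.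
Proof.
move: (inner_ge0 x); rewrite /vnorm; case: (inner x x) => a b /=.
rewrite lecE /= => /andP[/eqP b0 a0] h.
have -> : a = 1 by rewrite -(sqr_sqrtr a0) h expr1n.
by apply/eqP; rewrite eq_complex /= b0 !eqxx.
Qed.

Lemma independent_family_size (d m : nat) (S : {vspace 'M[C]_d})
    (xi : 'I_m -> 'cV[C]_d) :
  independent_family S xi -> (m <= d)%N.
Proof.
case=> h1 h2 _; pose X : 'M[C]_(d, m) := \matrix_(i, j) xi j i 0.
suff X1 : adj X *m X = 1%:M.
  have := mulmx_max_rank (adj X) X.
  by rewrite X1 mxrank1.
apply/matrixP => i j; rewrite !mxE.
transitivity (inner (xi j) (xi i)).
  by apply: eq_bigr => k _; rewrite !mxE mulrC.
have [->|ij] := eqVneq i j; first by rewrite inner_unit.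
by rewrite h2 // eq_sym.
Qed.

(* The bound m <= d loses nothing, by independent_family_size. *)
Definition independence_number {d : nat} (S : {vspace 'M[C]_d}) : nat :=
  \max_(m < d.+1 | `[< exists xi : 'I_m -> 'cV[C]_d,
                        independent_family S xi >]) m.

Definition tens_vs {d e : nat} (S : {vspace 'M[C]_d}) (T : {vspace 'M[C]_e}) :
    {vspace 'M[C]_(d * e)} :=
  <<[seq tensmx A B | A <- vbasis S, B <- vbasis T]>>%VS.

(* tens_vs S T is the span of all elementary tensors, whatever the bases. *)
Lemma tens_vsP (d e : nat) (S : {vspace 'M[C]_d}) (T : {vspace 'M[C]_e})
    (U : {vspace 'M[C]_(d * e)}) :
  (tens_vs S T <= U)%VS <->
  (forall A B, A \in S -> B \in T -> tensmx A B \in U).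
Proof.
split=> [/span_subvP h A B AS BT|h]; last first.
  apply/span_subvP => _ /allpairsP[[A B] /= [AS BT ->]].
  by apply: h; apply: vbasis_mem.
have tZD (a : C) A1 A2 (B1 : 'M[C]_e) :
    tensmx (a *: A1 + A2 : 'M[C]_d) B1 = a *: tensmx A1 B1 + tensmx A2 B1.
  by apply/matrixP=> i j; rewrite !mxE mulrDl mulrA.
have tDZ (a : C) (A1 : 'M[C]_d) B1 B2 :
    tensmx A1 (a *: B1 + B2 : 'M[C]_e) = a *: tensmx A1 B1 + tensmx A1 B2.
  by apply/matrixP=> i j; rewrite !mxE mulrDr mulrCA.
rewrite (coord_vbasis AS) (coord_vbasis BT).
elim/big_rec: _ => [|i A' _ IHA]; first by rewrite tens0mx mem0v.
rewrite tZD memvD // memvZ //.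
elim/big_rec: _ => [|j B' _ IHB]; first by rewrite tensmx0 mem0v.
rewrite tDZ memvD // memvZ //; apply: h; apply/allpairsP.
by exists ((vbasis S)`_i, (vbasis T)`_j); split=> //=;
  rewrite mem_nth // size_tuple.
Qed.

Fixpoint tpow_dim (d n : nat) : nat :=
  if n is n'.+1 then (d * tpow_dim d n')%N else 1%N.

Fixpoint tpow {d : nat} (S : {vspace 'M[C]_d}) (n : nat) :
    {vspace 'M[C]_(tpow_dim d n)} :=
  if n is n'.+1 then tens_vs S (tpow S n') else fullv.

Definition shannon_capacity {d : nat} (S : {vspace 'M[C]_d}) : R :=
  limn (fun n : nat => (independence_number (tpow S n))%:R `^ (n%:R^-1) : R).

End NoncommutativeGraph.

Section Channels.
Context {R : realType}.
Local Notation C := R[i].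

(* The (i, j) entry, in L(C^d), of T in M_n(L(C^d)) = L(C^n (x) C^d). *)
Definition mxtens_block {n d : nat} (T : 'M[C]_(n * d)) (i j : 'I_n) :
    'M[C]_d :=
  \matrix_(a, b) T (mxtens_index (i, a)) (mxtens_index (j, b)).

Definition ampliation {d k : nat} (n : nat) (Phi : 'M[C]_d -> 'M[C]_k)
    (T : 'M[C]_(n * d)) : 'M[C]_(n * k) :=
  \sum_(i < n) \sum_(j < n) tensmx (delta_mx i j) (Phi (mxtens_block T i j)).

Definition completely_positive {d k : nat} (Phi : {linear 'M[C]_d -> 'M[C]_k}) :
    Prop :=
  forall (n : nat) (T : 'M[C]_(n * d)), psd T -> psd (ampliation Phi T).

Definition trace_preserving {d k : nat} (Phi : {linear 'M[C]_d -> 'M[C]_k}) :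
    Prop :=
  forall T : 'M[C]_d, \tr (Phi T) = \tr T.

Definition quantum_channel {d k : nat} (Phi : {linear 'M[C]_d -> 'M[C]_k}) :
    Prop :=
  completely_positive Phi /\ trace_preserving Phi.

Definition kraus_representation {d k m : nat}
    (Phi : {linear 'M[C]_d -> 'M[C]_k}) (A : 'I_m -> 'M[C]_(k, d)) : Prop :=
  forall T : 'M[C]_d, Phi T = \sum_(p < m) A p *m T *m adj (A p).

Definition kraus_span {d k m : nat} (A : 'I_m -> 'M[C]_(k, d)) :
    {vspace 'M[C]_d} :=
  <<[seq adj (A p) *m A q | p <- enum 'I_m, q <- enum 'I_m]>>%VS.

(* The span does not depend on the Kraus representation, which exists for
   every completely positive map, so one representation is enough. *)
Definition channel_of_graph {d k : nat} (S : {vspace 'M[C]_d})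
    (Phi : {linear 'M[C]_d -> 'M[C]_k}) : Prop :=
  quantum_channel Phi /\
  exists (m : nat) (A : 'I_m -> 'M[C]_(k, d)),
    kraus_representation Phi A /\ (kraus_span A <= S)%VS.

Definition dual_map {d k : nat} (Phi : {linear 'M[C]_d -> 'M[C]_k})
    (S : 'M[C]_k) : 'M[C]_d :=
  \matrix_(i, j) \tr (Phi (delta_mx j i) *m S).

Lemma dual_mapP (d k : nat) (Phi : {linear 'M[C]_d -> 'M[C]_k})
    (T : 'M[C]_d) (S : 'M[C]_k) :
  \tr (T *m dual_map Phi S) = \tr (Phi T *m S).
Proof.
rewrite [in RHS](matrix_sum_delta T) linear_sum mulmx_suml raddf_sum /=.
apply: eq_bigr => i _.
rewrite linear_sum mulmx_suml raddf_sum mxE /=; apply: eq_bigr => j _.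
by rewrite linearZ -scalemxAl mxtraceZ mxE.
Qed.

Definition theta_hat {d : nat} (S : {vspace 'M[C]_d}) : R :=
  inf [set t : R | exists (k : nat) (Phi : {linear 'M[C]_d -> 'M[C]_k})
                     (sigma : 'M[C]_k),
    [/\ channel_of_graph S Phi, psd sigma, \tr sigma <= 1,
        dual_map Phi sigma \in unitmx
      & t = opnorm (invmx (dual_map Phi sigma))]].

End Channels.

(* Main.v *)
Require Import Defs.
From mathcomp Require Import all_boot all_order all_algebra.
From mathcomp Require Import complex mxtens spectral ring.
From mathcomp Require Import all_classical all_reals all_analysis.

(** Let a channel with Kraus operators [B p], all products [adj (B p) *m B q]
    lying in [S], and a positive [sigma] of trace at most 1 be given, and put
    [rho = \sum_p adj (B p) *m sigma *m B p], the image of [sigma] under the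
    dual map.  If [xi] is an [S]-independent family, the channel maps the pure
    states [outer (xi i) (xi i)] to states with mutually orthogonal supports:
    it sends classical messages without error.  States with orthogonal supports
    sum to at most the identity ([psd_sum_orthogonal]), so pairing that sum
    with [sigma] gives [\sum_i inner (rho *m xi i) (xi i) <= \tr sigma <= 1].
    If moreover [c * rho >= 1], each unit vector [xi i] contributes at least
    [1 / c], and the family has at most [c] members
    ([independent_le_certificate]).

    The best [c] is the operator norm of the inverse of [rho]
    ([psd_opnorm_inv]), which is the quantity minimised in [theta_hat].
    All these data can be tensored, with the constants [c] multiplying
    ([certificate_tens]); hence the independence number of the [n]-th tensor
    power is at most [c ^+ n], and its [n]-th root is at most [c].

    Everything is expressed with Kraus operators, since the inequality
    [c * rho >= 1] and the inclusion of the Kraus products pass to tensor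
    products by bilinearity and the positivity of tensor products of positive
    matrices, without tensor products of linear maps or the norm of a tensor
    product. *)

Set Implicit Arguments.
Unset Strict Implicit.
Unset Printing Implicit Defensive.

Import Order.TTheory GRing.Theory Num.Theory.
Import numFieldNormedType.Exports.

Local Open Scope ring_scope.

(** * Adjoints and inner products *)

Section Adjoint.
Context {R : realType}.
Local Notation C := R[i].

Lemma adjE m n (A : 'M[C]_(m, n)) i j : adj A i j = (A j i)^*.
Proof. by rewrite !mxE. Qed.

Lemma adjK m n (A : 'M[C]_(m, n)) : adj (adj A) = A.
Proof. by apply/matrixP => i j; rewrite !adjE conjCK. Qed.

Lemma adjM m n p (A : 'M[C]_(m, n)) (B : 'M[C]_(n, p)) :
  adj (A *m B) = adj B *m adj A.
Proof. by rewrite /adj trmx_mul map_mxM. Qed.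

Lemma adj1 n : adj 1%:M = 1%:M :> 'M[C]_n.
Proof. by rewrite /adj trmx1 map_mx1. Qed.

Lemma adjB m n (A B : 'M[C]_(m, n)) : adj (A - B) = adj A - adj B.
Proof. by rewrite /adj linearB map_mxB. Qed.

Lemma adj_sum m n (I : finType) (F : I -> 'M[C]_(m, n)) :
  adj (\sum_i F i) = \sum_i adj (F i).
Proof. by rewrite /adj linear_sum map_mx_sum. Qed.

Lemma adj_tens m n p q (A : 'M[C]_(m, n)) (B : 'M[C]_(p, q)) :
  adj (tensmx A B) = tensmx (adj A) (adj B).
Proof. by rewrite /adj trmx_tens map_mxT. Qed.

Lemma innerE n (x y : 'cV[C]_n) : inner x y = (adj y *m x) 0 0.
Proof. by rewrite mxE; apply: eq_bigr => i _; rewrite adjE mulrC. Qed.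

Lemma inner_mulmx m n (A : 'M[C]_(m, n)) x y :
  inner (A *m x) y = inner x (adj A *m y).
Proof. by rewrite !innerE adjM adjK mulmxA. Qed.

Lemma inner_gram m n (G : 'M[C]_(m, n)) x :
  inner (adj G *m G *m x) x = inner (G *m x) (G *m x).
Proof. by rewrite -mulmxA inner_mulmx adjK. Qed.

Lemma innerB n (x y z : 'cV[C]_n) : inner (x - y) z = inner x z - inner y z.
Proof. by rewrite !innerE mulmxBr !mxE. Qed.

Lemma inner_scale2 n c (x : 'cV[C]_n) :
  inner (c *: x) (c *: x) = c * c^* * inner x x.
Proof.
rewrite /inner big_distrr; apply: eq_bigr => i _ /=.
by rewrite !mxE rmorphM; ring.
Qed.

Lemma inner_scale n c (x y : 'cV[C]_n) : inner (c *: x) y = c * inner x y.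
Proof. by rewrite !innerE -scalemxAr mxE. Qed.

Lemma inner_mul_outer n A (x : 'cV[C]_n) :
  inner (A *m x) x = \tr (A *m outer x x).
Proof.
by rewrite innerE (mulmxA A) (mxtrace_mulC (A *m x)) /mxtrace big_ord1.
Qed.

Lemma vnormE n (x : 'cV[C]_n) : inner x x = ((vnorm x) ^+ 2)%:C%C.
Proof.
move: (inner_ge0 x); rewrite /vnorm; case: (inner x x) => a b /=.
rewrite lecE /= => /andP[/eqP -> a0].
by rewrite sqr_sqrtr.
Qed.

End Adjoint.

(** * Positive semidefinite matrices *)

Section Positivity.
Context {R : realType}.
Local Notation C := R[i].

Lemma psdD n (A B : 'M[C]_n) : psd A -> psd B -> psd (A + B).
Proof.
move=> hA hB x; rewrite mulmxDl innerE mulmxDr mxE -!innerE.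
exact: addr_ge0.
Qed.

Lemma psd0 n : psd (0 : 'M[C]_n).
Proof. by move=> x; rewrite mul0mx innerE mulmx0 mxE. Qed.

Lemma psd_sum n (I : finType) (F : I -> 'M[C]_n) :
  (forall i, psd (F i)) -> psd (\sum_i F i).
Proof.
by move=> hF; elim/big_ind: _ => //; [exact: psd0|exact: psdD].
Qed.

Lemma psd_scale n (c : C) (A : 'M[C]_n) : 0 <= c -> psd A -> psd (c *: A).
Proof.
move=> c0 hA x; rewrite -scalemxAl innerE -scalemxAr mxE -innerE.
exact: mulr_ge0.
Qed.

Lemma psd_conj m n (G : 'M[C]_(m, n)) (A : 'M[C]_m) :
  psd A -> psd (adj G *m A *m G).
Proof.
by move=> hA x; rewrite -!mulmxA inner_mulmx adjK.
Qed.

Lemma psd1 n : psd (1%:M : 'M[C]_n).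
Proof. by move=> x; rewrite mul1mx inner_ge0. Qed.

Lemma psd_gram m n (G : 'M[C]_(m, n)) : psd (adj G *m G).
Proof. by rewrite -[adj G]mulmx1; apply/psd_conj/psd1. Qed.

Lemma psd_diag n (l : 'rV[C]_n) : (forall j, 0 <= l 0 j) -> psd (diag_mx l).
Proof.
move=> l0 x; apply: sumr_ge0 => i _; rewrite mul_diag_mx mxE -mulrA.
by rewrite mulr_ge0 // mul_conjC_ge0.
Qed.

Lemma entryE n (A : 'M[C]_n) i j :
  (adj (delta_mx i 0 : 'cV[C]_n) *m A *m (delta_mx j 0 : 'cV[C]_n)) 0 0 = A i j.
Proof.
rewrite -mulmxA -colE mxE (bigD1 i) //= big1 ?addr0 => [|p pi].
  by rewrite !mxE !eqxx rmorph1 mul1r.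
by rewrite !mxE (negPf pi) rmorph0 mul0r.
Qed.

(** Polarization: the quadratic form is real at [delta_i + c delta_j], and the
    choices [c = 1] and [c = 'i] together determine the entry [A i j] from
    [A j i]. *)
Lemma psd_hermitian n (A : 'M[C]_n) : psd A -> adj A = A.
Proof.
move=> hA; apply/matrixP => i j; rewrite adjE.
pose f c : 'cV[C]_n := delta_mx i 0 + c *: delta_mx j 0.
have quad c : inner (A *m f c) (f c) =
    (A i i + c * c^* * A j j) + (c * A i j + c^* * A j i).
  rewrite innerE mulmxA.
  have -> : adj (f c) = adj (delta_mx i 0) + c^* *: adj (delta_mx j 0).
    by apply/matrixP => p q; rewrite !mxE rmorphD rmorphM.
  rewrite !mulmxDl !mulmxDr -!scalemxAl -!scalemxAr.
  have eD (M N : 'M[C]_1) : (M + N) 0 0 = M 0 0 + N 0 0 by rewrite mxE.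
  have eZ z (M : 'M[C]_1) : (z *: M) 0 0 = z * M 0 0 by rewrite mxE.
  rewrite !(eD, eZ) !entryE.
  by ring.
have dreal k : A k k \is Num.real.
  by apply: ger0_real; move: (hA (delta_mx k 0)); rewrite innerE mulmxA entryE.
have off c : c * A i j + c^* * A j i \is Num.real.
  have -> : c * A i j + c^* * A j i =
      inner (A *m f c) (f c) - (A i i + c * c^* * A j j) by rewrite quad; ring.
  have cc : c * c^* \is Num.real by exact/ger0_real/mul_conjC_ge0.
  exact: rpredB (ger0_real (hA _)) (rpredD (dreal i) (rpredM cc (dreal j))).
have /CrealP e1 := off 1; have /CrealP := off 'i.
rewrite rmorph1 !mul1r rmorphD in e1.
rewrite conjCi rmorphD !rmorphM rmorphN /= conjCi => e2.
have {}e2 : (A j i)^* - (A i j)^* = A i j - A j i.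
  apply: (mulfI (neq0Ci C)).
  transitivity (- 'i * (A i j)^* + - - 'i * (A j i)^*); first by ring.
  by rewrite e2; ring.
apply: (mulfI (x := 2)); first by rewrite pnatr_eq0.
transitivity (((A i j)^* + (A j i)^*) + ((A j i)^* - (A i j)^*)); first by ring.
by rewrite e1 e2; ring.
Qed.

(** The spectral theorem for normal matrices; the eigenvalues are nonnegative
    because they are diagonal entries of a unitary conjugate of [A]. *)
Lemma psd_spectral n (A : 'M[C]_n) : psd A ->
  exists (U : 'M[C]_n) (l : 'rV[C]_n),
    [/\ adj U *m U = 1%:M, U *m adj U = 1%:M, forall j, 0 <= l 0 j
      & A = adj U *m diag_mx l *m U].
Proof.
move=> hA; have An : A \is normalmx.
  by apply/normalmxP; rewrite -/(adj A) psd_hermitian.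
have /orthomx_spectralP := An.
set U := spectralmx A; set l := spectral_diag A => eA.
have Uu : U \is unitarymx := spectral_unitarymx A.
have UV : U *m adj U = 1%:M by apply/unitarymxP.
have VU := mulmx1C UV.
rewrite invmx_unitary // -/(adj U) in eA.
exists U, l; split=> // j.
have -> : l 0 j = (U *m A *m adj U) j j.
  rewrite [in RHS]eA !mulmxA UV mul1mx -mulmxA UV mulmx1.
  by rewrite mxE eqxx mulr1n.
have := psd_conj (adj U) hA => /(_ (delta_mx j 0)).
by rewrite adjK innerE mulmxA entryE.
Qed.

Lemma psd_gramP n (A : 'M[C]_n) : psd A -> exists G : 'M[C]_n, A = adj G *m G.
Proof.
move=> /psd_spectral[U [l [_ _ l0 ->]]].
exists (diag_mx (map_mx sqrtC l) *m U).
rewrite adjM !mulmxA -[in RHS](mulmxA (adj U)); congr (_ *m _ *m _).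
apply/matrixP => i j; rewrite mul_mx_diag !mxE eq_sym.
have [->|] := eqVneq i j; last by rewrite !mulr0n rmorph0 mul0r.
by rewrite !mulr1n conj_Creal ?ger0_real ?sqrtC_ge0 // -expr2 sqrtCK.
Qed.

(** A Gram factorization of each factor gives one of the tensor product. *)
Lemma psd_tens m n (A : 'M[C]_m) (B : 'M[C]_n) :
  psd A -> psd B -> psd (tensmx A B).
Proof.
move=> /psd_gramP[G ->] /psd_gramP[H ->].
by rewrite -tensmx_mul -adj_tens; exact: psd_gram.
Qed.

Lemma psd_trace_ge0 n (A : 'M[C]_n) : psd A -> 0 <= \tr A.
Proof.
move=> hA; apply: sumr_ge0 => i _.
by move: (hA (delta_mx i 0)); rewrite innerE mulmxA entryE.
Qed.

Lemma psd_mul_trace_ge0 n (A B : 'M[C]_n) :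
  psd A -> psd B -> 0 <= \tr (A *m B).
Proof.
move=> hA /psd_gramP[G ->]; rewrite mulmxA mxtrace_mulC mulmxA.
by apply: psd_trace_ge0; rewrite -{1}[G]adjK; exact: psd_conj.
Qed.

(** Each eigenvalue is at most the sum of all of them. *)
Lemma psd_le_trace n (A : 'M[C]_n) : psd A -> psd (\tr A *: 1%:M - A).
Proof.
move=> /psd_spectral[U [l [UU UV l0 eA]]].
have -> : \tr A = \sum_j l 0 j.
  rewrite eA mxtrace_mulC mulmxA UV mul1mx.
  by apply: eq_bigr => j _; rewrite mxE eqxx mulr1n.
have -> : (\sum_j l 0 j) *: 1%:M - A =
    adj U *m diag_mx (const_mx (\sum_j l 0 j) - l) *m U.
  rewrite linearB /= mulmxBr mulmxBl -eA diag_const_mx.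
  by rewrite -mulmxA mul_scalar_mx -scalemxAr UU.
apply/psd_conj/psd_diag => j; rewrite !mxE (bigD1 j) //= addrAC subrr add0r.
by apply: sumr_ge0.
Qed.

End Positivity.

(** * The operator norm of an inverse *)

Section OperatorNorm.
Context {R : realType}.
Local Notation C := R[i].

Lemma vnorm_ge0 n (x : 'cV[C]_n) : 0 <= vnorm x.
Proof. exact: sqrtr_ge0. Qed.

Lemma vnorm0 n : vnorm (0 : 'cV[C]_n) = 0.
Proof. by rewrite /vnorm innerE mulmx0 mxE sqrtr0. Qed.

(** The supremum defining [opnorm] is a genuine one: the Hilbert-Schmidt norm
    bounds the set, as [adj A *m A] lies below its trace. *)
Lemma opnorm_has_sup n (A : 'M[C]_n) :
  has_sup [set vnorm (A *m x) | x in [set x : 'cV[C]_n | vnorm x <= 1]]%classic.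
Proof.
split; first by exists (vnorm (A *m 0)); exists 0 => //=; rewrite vnorm0.
exists (Num.sqrt (complex.Re (\tr (adj A *m A)))) => _ [x /= x1 <-].
apply: ler_wsqrtr.
suff : inner (A *m x) (A *m x) <= \tr (adj A *m A) by rewrite lecE => /andP[].
have /psd_le_trace/(_ x) := psd_gram A.
rewrite mulmxBl -scalemxAl mul1mx innerB inner_scale inner_gram subr_ge0.
move=> /le_trans; apply; rewrite vnormE ler_piMr ?psd_trace_ge0 //.
  exact: psd_gram.
by rewrite lecR expr_le1 ?vnorm_ge0.
Qed.

Lemma vnorm_le_opnorm n (A : 'M[C]_n) x :
  vnorm x <= 1 -> vnorm (A *m x) <= opnorm A.
Proof.
move=> x1; apply: (sup_upper_bound (opnorm_has_sup A)).
by exists x.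
Qed.

Lemma opnorm_ge0 n (A : 'M[C]_n) : 0 <= opnorm A.
Proof.
apply: le_trans (vnorm_ge0 (A *m 0)) _.
by apply: vnorm_le_opnorm; rewrite vnorm0.
Qed.

(** For an eigenvalue [l] of [A] with unit eigenvector [v], the vector
    [invmx A *m v] has norm [1 / l], so [opnorm (invmx A) * l >= 1]. *)
Lemma psd_opnorm_inv n (A : 'M[C]_n) : psd A -> A \in unitmx ->
  psd ((opnorm (invmx A))%:C%C *: A - 1%:M).
Proof.
move=> /psd_spectral[U [l [UU UV l0 eA]]] uA.
set t := opnorm _.
have -> : t%:C%C *: A - 1%:M =
    adj U *m diag_mx (t%:C%C *: l - const_mx 1) *m U.
  by rewrite linearB linearZ /= mulmxBr mulmxBl diag_const_mx mulmx1 UU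
    -scalemxAr -scalemxAl -eA.
apply/psd_conj/psd_diag => j; rewrite !mxE subr_ge0.
pose v : 'cV[C]_n := adj U *m delta_mx j 0.
have v1 : inner v v = 1.
  by rewrite -inner_gram adjK UV innerE mulmxA entryE mxE eqxx.
have Av : A *m v = l 0 j *: v.
  rewrite eA /v -!mulmxA (mulmxA U) UV mul1mx scalemxAr; congr (_ *m _).
  by apply/matrixP => p q; rewrite mul_diag_mx !mxE; case: eqVneq => [->|];
    rewrite ?mulr0.
have nv : vnorm v <= 1 by rewrite /vnorm v1 sqrtr1.
have := vnorm_le_opnorm (invmx A) nv; rewrite -/t => st.
set s := vnorm (invmx A *m v) in st.
have sl : s%:C%C * l 0 j = 1.
  have sl0 : 0 <= s%:C%C * l 0 j by rewrite mulr_ge0 // lecR vnorm_ge0.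
  apply/eqP; rewrite -(@pexpr_eq1 _ _ 2) //; apply/eqP.
  have : inner v v = 1 := v1.
  rewrite -{1 2}(mulKmx uA v) Av -scalemxAr inner_scale2 vnormE -/s => <-.
  by rewrite conj_Creal ?ger0_real // rmorphXn exprMn; ring.
by rewrite -sl ler_wpM2r // lecR.
Qed.

End OperatorNorm.

(** * States with orthogonal supports *)

Section OrthogonalStates.
Context {R : realType}.
Local Notation C := R[i].

(** Writing the states as [V i *m adj (V i)] avoids their support projections.
    With [P] their sum, orthogonality gives
    [P *m P = \sum_i V i *m (adj (V i) *m V i) *m adj (V i)], so that [1 - P]
    is the sum of [adj (1 - P) *m (1 - P)] and of the matrices
    [V i *m (1 - adj (V i) *m V i) *m adj (V i)].  These are positive because
    a positive matrix of trace at most 1 is at most 1. *)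
Lemma psd_sum_orthogonal k m (I : finType) (V : I -> 'M[C]_(k, m)) :
  (forall i j, i != j -> adj (V i) *m V j = 0) ->
  (forall i, \tr (adj (V i) *m V i) <= 1) ->
  psd (1%:M - \sum_i V i *m adj (V i)).
Proof.
move=> orth tr1; set P := \sum_i _.
have Padj : adj P = P.
  by rewrite adj_sum; apply: eq_bigr => i _; rewrite adjM adjK.
have PP : P *m P = \sum_i V i *m (adj (V i) *m V i) *m adj (V i).
  rewrite {1}/P mulmx_suml; apply: eq_bigr => i _.
  rewrite mulmx_sumr (bigD1 i) //= big1 ?addr0 ?mulmxA // => j ji.
  by rewrite mulmxA -(mulmxA (V i)) orth 1?eq_sym // mulmx0 mul0mx.
have -> : 1%:M - P = adj (1%:M - P) *m (1%:M - P) +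
    \sum_i V i *m (1%:M - adj (V i) *m V i) *m adj (V i).
  under eq_bigr do rewrite mulmxBr mulmxBl mulmx1.
  rewrite sumrB -/P -PP adjB adj1 Padj mulmxBl !mulmxBr !mulmx1 !mul1mx.
  by rewrite [RHS]subrK.
apply: psdD; first exact: psd_gram.
apply: psd_sum => i; rewrite -{1}[V i]adjK; apply: psd_conj.
set G := adj (V i) *m V i.
have -> : 1%:M - G = (1 - \tr G) *: 1%:M + (\tr G *: 1%:M - G).
  by rewrite scalerBl scale1r addrA subrK.
apply: psdD; last exact/psd_le_trace/psd_gram.
by apply: psd_scale; [rewrite subr_ge0 tr1|exact: psd1].
Qed.

End OrthogonalStates.

(** * Bounds on independence numbers and their tensor powers *)

Section Certificates.
Context {R : realType}.
Local Notation C := R[i].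

(** The data of a point of the set minimised in [theta_hat], in a form stable
    under tensor products: [B] is a Kraus family of the channel, the first
    equation is trace preservation, and the last condition replaces the bound
    [c] on the norm of the inverse of the dual image of [sigma]. *)
Definition channel_certificate d (S : {vspace 'M[C]_d}) (c : R) : Prop :=
  0 <= c /\
  exists (k : nat) (I : finType) (B : I -> 'M[C]_(k, d)) (sigma : 'M[C]_k),
    [/\ \sum_p adj (B p) *m B p = 1%:M,
        forall p q, adj (B p) *m B q \in S,
        psd sigma, \tr sigma <= 1
      & psd (c%:C%C *: (\sum_p adj (B p) *m sigma *m B p) - 1%:M)].

Lemma mxtrace_adj_conj k d (B : 'M[C]_(k, d)) (T : 'M[C]_d) (X : 'M[C]_k) :
  \tr (B *m T *m adj B *m X) = \tr (adj B *m X *m B *m T).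
Proof. by rewrite -mulmxA mxtrace_mulC !mulmxA. Qed.

Lemma independent_le_certificate d (S : {vspace 'M[C]_d}) c m
    (xi : 'I_m -> 'cV[C]_d) :
  channel_certificate S c -> independent_family S xi -> m%:R <= c.
Proof.
move=> [c0 [k [I [B [sigma [B1 BS sig0 sig1]]]]]]; set rho := \sum_p _ => hrho.
move=> [xi1 _ xiS].
(* The columns of [V i] are the vectors [B p *m xi i], so [V i *m adj (V i)]
   is the image of the pure state of [xi i] under the channel. *)
pose V i : 'M[C]_(k, #|I|) := \matrix_(a, p) (B (enum_val p) *m xi i) a 0.
have VV i j p q : (adj (V i) *m V j) p q =
    \tr (adj (B (enum_val p)) *m B (enum_val q) *m outer (xi j) (xi i)).
  transitivity (inner (B (enum_val q) *m xi j) (B (enum_val p) *m xi i)).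
    by rewrite mxE; apply: eq_bigr => a _; rewrite adjE !mxE mulrC.
  rewrite innerE adjM /outer [in RHS]mulmxA [RHS]mxtrace_mulC.
  by rewrite /mxtrace big_ord1 !mulmxA.
have VVadj i : V i *m adj (V i) =
    \sum_p B p *m outer (xi i) (xi i) *m adj (B p).
  apply/matrixP => a b; rewrite mxE summxE.
  rewrite (reindex (@enum_val _ I)) /=; last exact/onW_bij/enum_val_bij.
  apply: eq_bigr => p _.
  have -> : B (enum_val p) *m outer (xi i) (xi i) *m adj (B (enum_val p)) =
      outer (B (enum_val p) *m xi i) (B (enum_val p) *m xi i).
    by rewrite /outer adjM !mulmxA.
  by rewrite [RHS]mxE big_ord1 !adjE [V i a p]mxE [V i b p]mxE.
have trV X i : \tr (V i *m adj (V i) *m X) =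
    inner ((\sum_p adj (B p) *m X *m B p) *m xi i) (xi i).
  rewrite inner_mul_outer VVadj !mulmx_suml !raddf_sum /=.
  by apply: eq_bigr => p _; exact: mxtrace_adj_conj.
have hP : psd (1%:M - \sum_i V i *m adj (V i)).
  apply: psd_sum_orthogonal => [i j ij|i].
    apply/matrixP => p q; rewrite VV mxE.
    have := xiS j i; rewrite eq_sym => /(_ ij _ (BS (enum_val q) (enum_val p))).
    by rewrite /HS_inner adjM adjK.
  rewrite mxtrace_mulC -[V i *m _]mulmx1 trV.
  under eq_bigr do rewrite mulmx1.
  by rewrite B1 mul1mx inner_unit.
have := psd_mul_trace_ge0 hP sig0.
rewrite mulmxBl mul1mx raddfB /= subr_ge0 mulmx_suml raddf_sum /= => le1.
have : (m%:R)%:C%C <= c%:C%C * \sum_i inner (rho *m xi i) (xi i).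
  rewrite mulr_sumr rmorph_nat -[m in m%:R]card_ord -sumr_const.
  apply: ler_sum => i _; have := hrho (xi i).
  rewrite mulmxBl -scalemxAl mul1mx innerB inner_scale inner_unit //.
  by rewrite subr_ge0.
(* Pairing with [sigma] preserves the inequality between the sum of the
   output states and the identity. *)
have S1 : \sum_i inner (rho *m xi i) (xi i) <= 1.
  apply: le_trans sig1; apply: le_trans le1.
  by rewrite (eq_bigr _ (fun i _ => trV sigma i)).
move=> /le_trans -/(_ _ (ler_piMr _ S1)).
by rewrite !lecR; apply.
Qed.

Lemma tensmx_sum (I J : finType) m n p q
    (F : I -> 'M[C]_(m, n)) (G : J -> 'M[C]_(p, q)) :
  \sum_(x : I * J) tensmx (F x.1) (G x.2) = tensmx (\sum_i F i) (\sum_j G j).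
Proof.
apply/matrixP => a b; rewrite summxE [RHS]mxE !summxE big_distrlr /= pair_big.
by apply: eq_bigr => x _; rewrite !mxE.
Qed.

Lemma tensmx11 m n : tensmx 1%:M 1%:M = 1%:M :> 'M[C]_(m * n).
Proof.
apply/matrixP => i j; case: (mxtens_indexP i) => {}i i'.
case: (mxtens_indexP j) => {}j j'.
rewrite tensmxE !mxE (can_eq (@mxtens_indexK m n)) xpair_eqE.
by case: eqP; case: eqP; rewrite ?mulr1 ?mulr0.
Qed.

Lemma mxtrace_tens m n (A : 'M[C]_m) (B : 'M[C]_n) :
  \tr (tensmx A B) = \tr A * \tr B.
Proof.
rewrite /mxtrace mulr_sum; apply: eq_bigr => i _.
by rewrite mxE.
Qed.

(** The trace bound, the Kraus products and trace preservation multiply out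
    factor by factor.  For the last condition, with [X = c rA] and [Y = c' rB],
    [X (x) Y - 1 = (X - 1) (x) Y + 1 (x) (Y - 1)] is a sum of tensor products
    of positive matrices. *)
Lemma certificate_tens d e (S : {vspace 'M[C]_d}) (T : {vspace 'M[C]_e}) c c' :
  channel_certificate S c -> channel_certificate T c' ->
  channel_certificate (tens_vs S T) (c * c').
Proof.
move=> [c0 [k [I [A [s [A1 AS s0 s1]]]]]]; set rA := \sum_p _ => hA.
move=> [c0' [l [J [B [t [B1 BT t0 t1]]]]]]; set rB := \sum_p _ => hB.
split; first exact: mulr_ge0.
exists (k * l)%N, (I * J)%type, (fun x => tensmx (A x.1) (B x.2)), (tensmx s t).
split.
- under eq_bigr do rewrite adj_tens tensmx_mul.
  by rewrite (tensmx_sum (fun i => adj (A i) *m A i)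
    (fun j => adj (B j) *m B j)) A1 B1 tensmx11.
- move=> p q; rewrite adj_tens tensmx_mul.
  exact: (tens_vsP S T _).1 (subvv _) _ _ (AS _ _) (BT _ _).
- exact: psd_tens.
- by rewrite mxtrace_tens mulr_ile1 ?psd_trace_ge0.
under eq_bigr do rewrite adj_tens !tensmx_mul.
rewrite (tensmx_sum (fun i => adj (A i) *m s *m A i)
  (fun j => adj (B j) *m t *m B j)) -/rA -/rB.
have -> : (c * c')%:C%C *: tensmx rA rB - 1%:M =
    tensmx (c%:C%C *: rA - 1%:M) (c'%:C%C *: rB) +
    tensmx 1%:M (c'%:C%C *: rB - 1%:M).
  rewrite -tensmx11 rmorphM; apply/matrixP => i j; rewrite !mxE.
  by ring.
apply: psdD; apply: psd_tens => //; last exact: psd1.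
by rewrite -(subrK 1%:M (_ *: rB)); apply: psdD => //; exact: psd1.
Qed.

(** The zeroth tensor power is the full graph on the one-dimensional space. *)
Lemma certificate_fullv1 : channel_certificate (fullv : {vspace 'M[C]_1}) 1.
Proof.
split=> //; exists 1%N, unit, (fun _ => 1%:M), 1%:M; split.
- by rewrite big_const card_unit /= addr0 adj1 mulmx1.
- by move=> p q; rewrite memvf.
- exact: psd1.
- by rewrite mxtrace1.
rewrite big_const card_unit /= addr0 adj1 !mulmx1 scale1r subrr.
exact: psd0.
Qed.

Lemma certificate_tpow d (S : {vspace 'M[C]_d}) c n :
  channel_certificate S c -> channel_certificate (tpow S n) (c ^+ n).
Proof.
move=> hS; elim: n => [|n IH]; first exact: certificate_fullv1.
by rewrite exprS; exact: certificate_tens.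
Qed.

Lemma independence_number_le_certificate d (S : {vspace 'M[C]_d}) c :
  channel_certificate S c -> (independence_number S)%:R <= c.
Proof.
move=> hS; rewrite /independence_number.
elim/big_ind: _ => [|x y hx hy|m /asboolP[xi]].
- by case: hS.
- by rewrite /maxn; case: ifP.
exact: independent_le_certificate.
Qed.

End Certificates.

(** * Channels and the Shannon capacity *)

Section Channels.
Context {R : realType}.
Local Notation C := R[i].

Lemma mxtrace_mul_delta n (M : 'M[C]_n) i j : \tr (M *m delta_mx j i) = M i j.
Proof.
rewrite /mxtrace (bigD1 i) //= [X in _ + X]big1 ?addr0 => [|p /negPf pi].
  rewrite mxE (bigD1 j) //= big1 ?addr0 => [|p /negPf pj].
    by rewrite mxE !eqxx mulr1.
  by rewrite mxE pj mulr0.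
by rewrite mxE big1 // => q _; rewrite mxE pi andbF mulr0.
Qed.

Lemma mxtrace_kraus d k m (Phi : {linear 'M[C]_d -> 'M[C]_k})
    (A : 'I_m -> 'M[C]_(k, d)) X T : kraus_representation Phi A ->
  \tr (Phi T *m X) = \tr ((\sum_p adj (A p) *m X *m A p) *m T).
Proof.
move=> ->; rewrite !mulmx_suml !raddf_sum /=; apply: eq_bigr => p _.
exact: mxtrace_adj_conj.
Qed.

Lemma certificate_channel d k (S : {vspace 'M[C]_d})
    (Phi : {linear 'M[C]_d -> 'M[C]_k}) (sigma : 'M[C]_k) :
  channel_of_graph S Phi -> psd sigma -> \tr sigma <= 1 ->
  dual_map Phi sigma \in unitmx ->
  channel_certificate S (opnorm (invmx (dual_map Phi sigma))).
Proof.
move=> [[_ tp] [m [A [kr sub]]]] sig0 sig1 uD; split; first exact: opnorm_ge0.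
have eD : dual_map Phi sigma = \sum_p adj (A p) *m sigma *m A p.
  by apply/matrixP => i j; rewrite mxE (mxtrace_kraus _ _ kr) mxtrace_mul_delta.
exists k, 'I_m, A, sigma; split=> //.
- apply/matrixP => i j; rewrite -[LHS]mxtrace_mul_delta.
  have := mxtrace_kraus 1%:M (delta_mx j i) kr.
  under [X in _ = \tr (X *m _)]eq_bigr do rewrite mulmx1.
  move=> <-; rewrite mulmx1 tp -[delta_mx j i]mul1mx.
  by rewrite mxtrace_mul_delta.
- move=> p q; apply: (subvP sub); apply: memv_span.
  by apply/allpairsP; exists (p, q); rewrite !mem_enum.
rewrite -eD; apply: psd_opnorm_inv => //.
by rewrite eD; apply: psd_sum => p; exact: psd_conj.
Qed.

Lemma ampliation_id d n (T : 'M[C]_(n * d)) : ampliation idfun T = T.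
Proof.
apply/matrixP => a b; case: (mxtens_indexP a) => i {}a.
case: (mxtens_indexP b) => j {}b.
rewrite summxE (bigD1 i) //= [X in _ + X]big1 ?addr0; last first.
  move=> p /negPf pi; rewrite summxE big1 // => q _.
  by rewrite tensmxE mxE eq_sym pi mul0r.
rewrite summxE (bigD1 j) //= [X in _ + X]big1 ?addr0; last first.
  by move=> q /negPf qj; rewrite tensmxE mxE (eq_sym j) qj andbF mul0r.
by rewrite tensmxE !mxE !eqxx mul1r.
Qed.

(** The identity channel with the maximally mixed [sigma].  This makes the set
    minimised in [theta_hat] nonempty; the infimum of the empty set would be
    0, whatever the capacity. *)
Lemma exists_admissible_channel d (S : {vspace 'M[C]_d}) : 1%:M \in S ->
  exists (k : nat) (Phi : {linear 'M[C]_d -> 'M[C]_k}) (sigma : 'M[C]_k),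
    [/\ channel_of_graph S Phi, psd sigma, \tr sigma <= 1
      & dual_map Phi sigma \in unitmx].
Proof.
move=> S1; pose Phi : {linear 'M[C]_d -> 'M[C]_d} := idfun.
have eD s : dual_map Phi s = s.
  by apply/matrixP => i j; rewrite mxE mxtrace_mulC mxtrace_mul_delta.
exists d, Phi, (d%:R^-1 *: 1%:M); split.
- split; first by split=> // n T hT; rewrite ampliation_id.
  exists 1%N, (fun _ => 1%:M); split.
    by move=> T; rewrite big_ord1 adj1 mulmx1 mul1mx.
  apply/span_subvP => _ /allpairsP[[p q] /= [_ _ ->]].
  by rewrite adj1 mulmx1.
- by apply: psd_scale; [rewrite invr_ge0 ler0n|exact: psd1].
- rewrite mxtraceZ mxtrace1; have [->|d0] := eqVneq (d%:R : C) 0.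
    by rewrite mulr0.
  by rewrite mulVf.
(* In dimension 0 the scalar [d%:R^-1] vanishes, but the only matrix there is
   the identity. *)
rewrite eD; case: d @Phi S S1 eD => [|d] *.
  by rewrite [_ *: _]flatmx0 -[0](flatmx0 1%:M) unitmx1.
by rewrite scalemx1 unitmxE det_scalar unitfE expf_neq0 // invr_eq0 pnatr_eq0.
Qed.

End Channels.

Theorem corollary5p5 (R : realType) (d : nat) (S : {vspace 'M[R[i]]_d})
    (hS : operator_system S) :
  shannon_capacity S <= theta_hat S.
Proof.
have [S1 _] := hS; rewrite /theta_hat; apply: lb_le_inf.
  have [k [Phi [sigma [h1 h2 h3 h4]]]] := exists_admissible_channel S1.
  by exists (opnorm (invmx (dual_map Phi sigma))), k, Phi, sigma.
move=> _ [k [Phi [sigma [hPhi sig0 sig1 uD ->]]]].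
have := certificate_channel hPhi sig0 sig1 uD; set t := opnorm _ => cert.
have t0 : 0 <= t by case: cert.
rewrite /shannon_capacity.
set u := (fun n : nat => _ : R).
(* The value [limn] of a divergent sequence is 0, which is at most [t]. *)
have [cu|ncu] := pselect (cvgn u); last by rewrite dvgP.
apply: limr_le => //; near=> n.
have n0 : (0 < n)%N by near: n; exists 1%N.
have -> : t = (t ^+ n) `^ n%:R^-1.
  by rewrite -powR_mulrn // -powRrM divff ?powRr1 // pnatr_eq0 -lt0n.
apply: ge0_ler_powR; rewrite ?nnegrE ?invr_ge0 ?ler0n ?exprn_ge0 //.
exact/independence_number_le_certificate/certificate_tpow.
Unshelve. all: by end_near.
Qed.
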